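(* Let $f:\mathbb{R}^{n_{\mathbf u}}\to\mathbb{R}$ be a convex differentiable function whose gradient is coordinate-wise Lipschitz continuous with constants $L_i>0$, $i=1,\dots,M$, i.e. $$\|\nabla_i f(\mathbf{u}+E^i h_i)-\nabla_i f(\mathbf{u})\|\le L_i\|h_i\|\qquad \forall\,\mathbf{u}\in\mathbb{R}^{n_{\mathbf u}},\ h_i\in\mathbb{R}^{n_{\mathbf u}^i},\ i=1,\dots,M.$$ Assume further that $f$ is strongly convex with respect to $\|\cdot\|_1$ with constant $\sigma_1>0$, i.e. $$f(\mathbf{w})\ge f(\mathbf{v})+\langle\nabla f(\mathbf{v}),\mathbf{w}-\mathbf{v}\rangle+\frac{\sigma_1}{2}\|\mathbf{w}-\mathbf{v}\|_1^2\qquad\forall\,\mathbf{w},\mathbf{v}\in\mathbb{R}^{n_{\mathbf u}}.$$ Let $\mathbf{u}_*$ be the optimal solution and $f^*$ the optimal value of the problem $\min_{\mathbf{u}\in \mathbf{U}} f(\mathbf{u})$ with $\mathbf{U}=\mathbf{U}^1\times\cdots\times\mathbf{U}^M$, and let $(\mathbf{u}_k)_{k\ge 0}$ be the sequence generated by Algorithm PCDM from any $\mathbf{u}_0\in\mathbf{U}$. Then for all $k\ge0$, $$f(\mathbf{u}_k)-f^*\le\left(1-\frac{2\sigma_1}{M(1+\sigma_1)}\right)^k\left(\frac12 r_0^2+f(\mathbf{u}_0)-f^*\right),$$ where $r_0=\|\mathbf{u}_0-\mathbf{u}_*\|_1$.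
   Context: Let $M\ge 1$, let $n_{\mathbf u}^1,\dots,n_{\mathbf u}^M$ be positive integers and $n_{\mathbf u}=\sum_{i=1}^M n_{\mathbf u}^i$. A vector $\mathbf{u}\in\mathbb{R}^{n_{\mathbf u}}$ is partitioned into blocks $\mathbf{u}=[(\mathbf{u}^1)^T\cdots(\mathbf{u}^M)^T]^T$ with $\mathbf{u}^i\in\mathbb{R}^{n_{\mathbf u}^i}$. The identity matrix is partitioned accordingly by columns as $I_{n_{\mathbf u}}=[E^1\ \cdots\ E^M]$ with $E^i\in\mathbb{R}^{n_{\mathbf u}\times n_{\mathbf u}^i}$, so $\mathbf{u}=\sum_i E^i\mathbf{u}^i$. The partial gradient is $\nabla_i f(\mathbf{u})=(E^i)^T\nabla f(\mathbf{u})\in\mathbb{R}^{n_{\mathbf u}^i}$. $\|\cdot\|$ and $\langle\cdot,\cdot\rangle$ denote the Euclidean norm and inner product. Given constants $L_i>0$, define the norm $\|\cdot\|_1$ on $\mathbb{R}^{n_{\mathbf u}}$ by $\|\mathbf{u}\|_1^2=\sum_{i=1}^M L_i\|\mathbf{u}^i\|^2$ (this is not the $\ell_1$-norm). The constraint sets $\mathbf{U}^i\subseteq\mathbb{R}^{n_{\mathbf u}^i}$ are nonempty, closed and convex, and the problem $\min_{\mathbf{u}\in\mathbf{U}} f(\mathbf{u})$ is assumed to have an optimal solution. Algorithm PCDM (Parallel Coordinate Descent Method): for $\mathbf{u}\in\mathbf{U}$ define $$\bar{\mathbf v}^i(\mathbf{u})=\arg\min_{\mathbf{v}^i\in\mathbf{U}^i}\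 \langle\nabla_i f(\mathbf{u}),\mathbf{v}^i-\mathbf{u}^i\rangle+\frac{L_i}{2}\|\mathbf{v}^i-\mathbf{u}^i\|^2,\quad i=1,\dots,M.$$ Choose $\mathbf{u}_0^i\in\mathbf{U}^i$ for all $i$; for $k\ge0$ set $$\mathbf{u}_{k+1}^i=\frac1M\bar{\mathbf v}^i(\mathbf{u}_k)+\frac{M-1}{M}\mathbf{u}_k^i,\quad i=1,\dots,M.$$ *)

(* Defs.v *)
From HB Require Import structures.
From mathcomp Require Import all_boot all_order all_algebra.
From mathcomp Require Import all_classical all_reals all_analysis.

Set Implicit Arguments.
Unset Strict Implicit.
Unset Printing Implicit Defensive.

Import Order.TTheory GRing.Theory Num.Theory.
Import numFieldNormedType.Exports.

Local Open Scope classical_set_scope.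
Local Open Scope ring_scope.

(* The norm that the library puts on matrices is the sup norm, so the Euclidean
   inner product and norm are defined here.  The topology is the same, hence so
   are [closed] and [differentiable]. *)
Definition dot (R : realType) (n : nat) (x y : 'cV[R]_n) : R :=
  \sum_(j < n) x j ord0 * y j ord0.

Definition enorm (R : realType) (n : nat) (x : 'cV[R]_n) : R :=
  Num.sqrt (dot x x).

Definition grad (R : realType) (n : nat) (f : 'cV[R]_n -> R) (u : 'cV[R]_n) :
    'cV[R]_n :=
  \col_(j < n) 'D_(delta_mx j ord0) f u.

Definition minimizer (R : realType) (T : Type) (A : set T) (g : T -> R) (x : T) :=
  A x /\ forall y, A y -> g x <= g y.

(* [inf] is a junk value 0 when g is unbounded below on A or A is empty; both are
   excluded as soon as g has a minimizer on A. *)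
Definition opt_value (R : realType) (T : Type) (A : set T) (g : T -> R) : R :=
  inf (g @` A).

(* Block vectors have size \sum_i n i; the i-th block of u is [submxcol u i],
   and E^i is the i-th block of columns of the identity matrix. *)
Definition Eblock (R : realType) (M : nat) (n : 'I_M -> nat) (i : 'I_M) :
    'M[R]_(\sum_(j < M) n j, n i) :=
  submxrow 1%:M i.

Definition pgrad (R : realType) (M : nat) (n : 'I_M -> nat)
    (f : 'cV[R]_(\sum_(j < M) n j) -> R) (i : 'I_M)
    (u : 'cV[R]_(\sum_(j < M) n j)) : 'cV[R]_(n i) :=
  (Eblock R n i)^T *m grad f u.

Definition norm1 (R : realType) (M : nat) (n : 'I_M -> nat) (L : 'I_M -> R)
    (u : 'cV[R]_(\sum_(j < M) n j)) : R :=
  Num.sqrt (\sum_(i < M) L i * enorm (submxcol u i) ^+ 2).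

Definition prodset (R : realType) (M : nat) (n : 'I_M -> nat)
    (U : forall i : 'I_M, set 'cV[R]_(n i)) : set 'cV[R]_(\sum_(j < M) n j) :=
  [set u | forall i, U i (submxcol u i)].

Definition coord_lipschitz (R : realType) (M : nat) (n : 'I_M -> nat)
    (f : 'cV[R]_(\sum_(j < M) n j) -> R) (L : 'I_M -> R) : Prop :=
  forall (u : 'cV[R]_(\sum_(j < M) n j)) (i : 'I_M) (h : 'cV[R]_(n i)),
    enorm (pgrad f i (u + Eblock R n i *m h) - pgrad f i u) <= L i * enorm h.

Definition strongly_convex1 (R : realType) (M : nat) (n : 'I_M -> nat)
    (f : 'cV[R]_(\sum_(j < M) n j) -> R) (L : 'I_M -> R) (sigma1 : R) : Prop :=
  forall w v : 'cV[R]_(\sum_(j < M) n j),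
    f v + dot (grad f v) (w - v) + sigma1 / 2 * norm1 L (w - v) ^+ 2 <= f w.

Definition coord_model (R : realType) (M : nat) (n : 'I_M -> nat)
    (f : 'cV[R]_(\sum_(j < M) n j) -> R) (L : 'I_M -> R)
    (u : 'cV[R]_(\sum_(j < M) n j)) (i : 'I_M) (v : 'cV[R]_(n i)) : R :=
  dot (pgrad f i u) (v - submxcol u i)
  + L i / 2 * enorm (v - submxcol u i) ^+ 2.

(* The coordinate model is strongly convex, so on a nonempty closed convex set
   its argmin is a single point; "v is the argmin" is expressed by
   [minimizer]. *)
Definition pcdm_seq (R : realType) (M : nat) (n : 'I_M -> nat)
    (f : 'cV[R]_(\sum_(j < M) n j) -> R) (L : 'I_M -> R)
    (U : forall i : 'I_M, set 'cV[R]_(n i))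
    (u : nat -> 'cV[R]_(\sum_(j < M) n j)) : Prop :=
  (forall i, U i (submxcol (u 0%N) i)) /\
  forall (k : nat) (i : 'I_M), exists v : 'cV[R]_(n i),
    minimizer (U i) (@coord_model R M n f L (u k) i) v /\
    submxcol (u k.+1) i =
      (1 / M%:R) *: v + ((M%:R - 1) / M%:R) *: submxcol (u k) i.

(* Main.v *)
Require Import Defs.
From HB Require Import structures.
From mathcomp Require Import all_boot all_order all_algebra.
From mathcomp Require Import all_classical all_reals all_analysis.
From mathcomp Require Import ring lra.

Set Implicit Arguments.
Unset Strict Implicit.
Unset Printing Implicit Defensive.

Import Order.TTheory GRing.Theory Num.Theory.
Import numFieldNormedType.Exports.

Local Open Scope classical_set_scope.
Local Open Scope ring_scope.

(** Let [D = f x - f ustar] be the gap of an iterate [x], [r] the distance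
    [norm1 L (x - ustar)], and [Phi = r ^+ 2 / 2 + D].  The theorem holds because
    one step of the method multiplies [Phi] by at most
    [1 - 2 * sigma1 / (M%:R * (1 + sigma1))], and [D <= Phi].

    Write [v] for the vector of block minimizers at [x], [d = v - x], and [xp] for
    the next iterate [x + d / M].

    - [parallel_descent]: [xp] is the average of the [M] points obtained from [x]
      by moving a single block all the way to [v].  Each of them obeys the descent
      inequality of its own block ([block_descent]), so convexity of [f] gives
      [f xp <= f x + (<grad f x, d> + |d|_1^2 / 2) / M].
    - [block_prox_vi]: the optimality conditions of the block problems sum to
      [0 <= <grad f x, y - v> + <d, y - v>_1] for every feasible [y].
    - [potential_step]: expand [|xp - y|_1^2] and add the two facts above.  The
      terms in [|d|_1^2] cancel, except for a nonpositive remainder, and the two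
      gradient terms telescope to [<grad f x, y - x> / M].

    For [y = ustar], strong convexity bounds that last product, so [Phi] drops by
    at least [(D + sigma1 * r ^+ 2 / 2) / M].  This is at least
    [2 * sigma1 / (1 + sigma1) * Phi / M]: after multiplication by [1 + sigma1],
    the claim reads [0 <= (1 - sigma1) * (D - sigma1 * r ^+ 2 / 2)], where the
    first factor is nonnegative by [modulus_le1] and the second by
    [quadratic_growth].

    No derivative is ever computed.  The gradient enters through the subgradient
    inequality contained in strong convexity and through its blockwise Lipschitz
    bound; the passages to the limit are all of the form [ler_geometric_error],
    with step sizes [2 ^- k]. *)

(** * The Euclidean inner product and its blocks *)

Lemma dotC (R : realType) n (x y : 'cV[R]_n) : dot x y = dot y x.
Proof. by apply: eq_bigr => j _; rewrite mulrC. Qed.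

Lemma dotDl (R : realType) n (x y z : 'cV[R]_n) :
  dot (x + y) z = dot x z + dot y z.
Proof. by rewrite -big_split; apply: eq_bigr => j _; rewrite mxE mulrDl. Qed.

Lemma dotZl (R : realType) n a (x y : 'cV[R]_n) : dot (a *: x) y = a * dot x y.
Proof. by rewrite mulr_sumr; apply: eq_bigr => j _; rewrite mxE mulrA. Qed.

Lemma dotDr (R : realType) n (x y z : 'cV[R]_n) :
  dot x (y + z) = dot x y + dot x z.
Proof. by rewrite dotC dotDl !(dotC x). Qed.

Lemma dotZr (R : realType) n a (x y : 'cV[R]_n) : dot x (a *: y) = a * dot x y.
Proof. by rewrite dotC dotZl dotC. Qed.

Lemma dotNl (R : realType) n (x y : 'cV[R]_n) : dot (- x) y = - dot x y.
Proof. by rewrite -scaleN1r dotZl mulN1r. Qed.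

Lemma dotNr (R : realType) n (x y : 'cV[R]_n) : dot x (- y) = - dot x y.
Proof. by rewrite dotC dotNl dotC. Qed.

Definition dotE := (dotDl, dotDr, dotNl, dotNr, dotZl, dotZr).

Lemma dot_ge0 (R : realType) n (x : 'cV[R]_n) : 0 <= dot x x.
Proof. by apply: sumr_ge0 => j _; rewrite -expr2 sqr_ge0. Qed.

Lemma enorm_sqr (R : realType) n (x : 'cV[R]_n) : enorm x ^+ 2 = dot x x.
Proof. by rewrite sqr_sqrtr // dot_ge0. Qed.

Lemma dot_mxE (R : realType) n (x y : 'cV[R]_n) :
  dot x y = (x^T *m y) ord0 ord0.
Proof. by rewrite mxE; apply: eq_bigr => j _; rewrite mxE. Qed.

Lemma dot_mulmx (R : realType) m n (A : 'M[R]_(m, n)) x y :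
  dot x (A *m y) = dot (A^T *m x) y.
Proof. by rewrite !dot_mxE trmx_mul trmxK mulmxA. Qed.

(** Expanding the square of [g - c *: h] bounds [2 * c * dot g h] by
    [|g|^2 + c ^+ 2 * |h|^2], without an appeal to Cauchy-Schwarz. *)
Lemma dot_le_of_enorm_le (R : realType) n (g h : 'cV[R]_n) (c : R) :
  0 < c -> enorm g <= c * enorm h -> dot g h <= c * dot h h.
Proof.
move=> c0 le_gh.
have := lerXn2r 2 (sqrtr_ge0 _) (mulr_ge0 (ltW c0) (sqrtr_ge0 _)) le_gh.
rewrite exprMn !enorm_sqr => gg_le.
have := dot_ge0 (g - c *: h).
rewrite !dotE (dotC h g) => ge0.
rewrite -(ler_pM2l c0); nra.
Qed.

Lemma submxcolZ (R : realType) M (n : 'I_M -> nat) a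
    (x : 'cV[R]_(\sum_(j < M) n j)) i :
  submxcol (a *: x) i = a *: submxcol x i.
Proof. by apply/matrixP => j k; rewrite !mxE. Qed.

Lemma dot_submxcol (R : realType) M (n : 'I_M -> nat)
    (x y : 'cV[R]_(\sum_(j < M) n j)) :
  dot x y = \sum_(i < M) dot (submxcol x i) (submxcol y i).
Proof.
rewrite dot_mxE -{1}(submxcolK x) -{1}(submxcolK y) tr_mxcol mul_mxrow_mxcol.
by rewrite summxE; apply: eq_bigr => i _; rewrite dot_mxE.
Qed.

Lemma pgradE (R : realType) M (n : 'I_M -> nat)
    (f : 'cV[R]_(\sum_(j < M) n j) -> R) i u :
  pgrad f i u = submxcol (grad f u) i.
Proof. by rewrite /pgrad /Eblock tr_submxrow trmx1 submxcol_mul mul1mx. Qed.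

Lemma dot_submxcol_Eblock (R : realType) M (n : 'I_M -> nat) (i j : 'I_M)
    (h : 'cV[R]_(n i)) :
  dot (submxcol (Eblock R n i *m h) j) (submxcol (Eblock R n i *m h) j)
    = if j == i then dot h h else 0.
Proof.
rewrite /Eblock -submxcol_mul -submxblockEh -(@mxdiagZ _ _ n).
case: eqVneq => [->|ne_ji]; first by rewrite submxblock_diag mul1mx.
rewrite mxblockK (negbTE ne_ji) mul0mx /dot big1 // => k _.
by rewrite mxE mul0r.
Qed.

(** * The weighted inner product *)

(** The inner product whose square norm is [norm1 L x ^+ 2]; expanding squares of
    [norm1] needs its bilinearity. *)
Definition dot1 (R : realType) M (n : 'I_M -> nat) (L : 'I_M -> R)
    (x y : 'cV[R]_(\sum_(j < M) n j)) : R :=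
  \sum_(i < M) L i * dot (submxcol x i) (submxcol y i).

Lemma dot1C (R : realType) M (n : 'I_M -> nat) (L : 'I_M -> R)
    (x y : 'cV[R]_(\sum_(j < M) n j)) : dot1 L x y = dot1 L y x.
Proof. by apply: eq_bigr => i _; rewrite dotC. Qed.

Lemma dot1Dl (R : realType) M (n : 'I_M -> nat) (L : 'I_M -> R)
    (x y z : 'cV[R]_(\sum_(j < M) n j)) :
  dot1 L (x + y) z = dot1 L x z + dot1 L y z.
Proof.
by rewrite -big_split; apply: eq_bigr => i _; rewrite submxcolD dotDl mulrDr.
Qed.

Lemma dot1Zl (R : realType) M (n : 'I_M -> nat) (L : 'I_M -> R) a
    (x y : 'cV[R]_(\sum_(j < M) n j)) :
  dot1 L (a *: x) y = a * dot1 L x y.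
Proof.
by rewrite mulr_sumr; apply: eq_bigr => i _; rewrite submxcolZ dotZl mulrCA.
Qed.

Lemma dot1Nl (R : realType) M (n : 'I_M -> nat) (L : 'I_M -> R)
    (x y : 'cV[R]_(\sum_(j < M) n j)) : dot1 L (- x) y = - dot1 L x y.
Proof. by rewrite -scaleN1r dot1Zl mulN1r. Qed.

Lemma dot1Dr (R : realType) M (n : 'I_M -> nat) (L : 'I_M -> R)
    (x y z : 'cV[R]_(\sum_(j < M) n j)) :
  dot1 L z (x + y) = dot1 L z x + dot1 L z y.
Proof. by rewrite dot1C dot1Dl !(dot1C _ z). Qed.

Lemma dot1Zr (R : realType) M (n : 'I_M -> nat) (L : 'I_M -> R) a
    (x y : 'cV[R]_(\sum_(j < M) n j)) :
  dot1 L x (a *: y) = a * dot1 L x y.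
Proof. by rewrite dot1C dot1Zl dot1C. Qed.

Lemma dot1Nr (R : realType) M (n : 'I_M -> nat) (L : 'I_M -> R)
    (x y : 'cV[R]_(\sum_(j < M) n j)) : dot1 L x (- y) = - dot1 L x y.
Proof. by rewrite dot1C dot1Nl dot1C. Qed.

Definition dot1E := (dot1Dl, dot1Dr, dot1Nl, dot1Nr, dot1Zl, dot1Zr).

Lemma dot1_ge0 (R : realType) M (n : 'I_M -> nat) (L : 'I_M -> R)
    (x : 'cV[R]_(\sum_(j < M) n j)) :
  (forall i, 0 < L i) -> 0 <= dot1 L x x.
Proof.
by move=> L0; apply: sumr_ge0 => i _; rewrite mulr_ge0 ?dot_ge0 // ltW.
Qed.

Lemma norm1_sqr (R : realType) M (n : 'I_M -> nat) (L : 'I_M -> R)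
    (x : 'cV[R]_(\sum_(j < M) n j)) :
  (forall i, 0 < L i) -> norm1 L x ^+ 2 = dot1 L x x.
Proof.
move=> L0; have eqL : norm1 L x = Num.sqrt (dot1 L x x).
  by congr Num.sqrt; apply: eq_bigr => i _; rewrite enorm_sqr.
by rewrite eqL sqr_sqrtr // dot1_ge0.
Qed.

(** * Limits along halving steps, and minimizers on convex sets *)

(** The substitute for a one-sided limit [t -> 0+]: testing an inequality at
    [t = 2 ^- k] removes an error term that is linear in [t]. *)
Lemma ler_geometric_error (R : realType) (a b c : R) :
  (forall k, a <= b + c * 2^-1 ^+ k) -> a <= b.
Proof.
move=> le_ab; rewrite leNgt; apply/negP => lt_ba.
have e0 : 0 < a - b by rewrite subr_gt0.
have /(_ _ (leqnn _)) := @upper_nthrootP R (c / (a - b)).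
set k := Num.bound _; rewrite ltr_pdivrMr // => lt_c.
have p0 : 0 < 2 ^+ k :> R by rewrite exprn_gt0.
have := le_ab k; rewrite -lerBlDl exprVn ler_pdivlMr // mulrC.
by move=> /(lt_le_trans lt_c); rewrite ltxx.
Qed.

Lemma segment_in_convex (R : realType) (E : lmodType R)
    (A : set (convex_lmodType E)) (v y : E) (t : R) :
  convex_set A -> A v -> A y -> 0 <= t -> t <= 1 -> A (v + t *: (y - v)).
Proof.
move=> cA Av Ay t0 t1.
have := cA y v (Itv01 t0 t1) (mem_set Ay) (mem_set Av) => /set_mem.
rewrite /conv /= /unstable.onem; congr (A _).
by rewrite scalerBl scale1r scalerBr addrCA.
Qed.

Lemma half_pow_itv (R : realType) k : 0 < (2^-1 : R) ^+ k <= 1.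
Proof.
rewrite exprn_gt0 ?invr_gt0 //=.
by rewrite exprn_ile1 // ?invr_ge0 // invf_le1 // ler1n.
Qed.

(** First-order optimality of a proximal step.  Moving from [v] towards [y] by a
    fraction [t] changes the quadratic model by
    [t * dot (g + c *: (v - x)) (y - v)] plus a term of order [t ^+ 2]; the change
    is nonnegative, so dividing by [t] and letting [t] vanish proves the claim. *)
Lemma minimizer_quadratic_vi (R : realType) n (A : set 'cV[R]_n)
    (g x v y : 'cV[R]_n) (c : R) :
  convex_set A ->
  minimizer A (fun z => dot g (z - x) + c / 2 * enorm (z - x) ^+ 2) v ->
  A y -> 0 <= dot (g + c *: (v - x)) (y - v).
Proof.
move=> cA [Av min_v] Ay.
apply: (@ler_geometric_error _ _ _ (c / 2 * dot (y - v) (y - v))) => k.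
have /andP[t0 t1] := half_pow_itv R k.
set t := 2^-1 ^+ k in t0 t1 *.
have := min_v _ (segment_in_convex cA Av Ay (ltW t0) t1).
rewrite addrAC; move: (y - v) (v - x) => d e.
rewrite !enorm_sqr !dotE (dotC d e) => le_t.
rewrite -(pmulr_rge0 _ t0); nra.
Qed.

Lemma opt_value_minimizer (R : realType) (T : Type) (A : set T) (g : T -> R) x :
  minimizer A g x -> opt_value A g = g x.
Proof.
move=> [Ax min_x].
have lb : lbound (g @` A) (g x) by move=> _ [y Ay <-]; exact: min_x.
apply/le_anti/andP; split.
  by apply: ge_inf; [exists (g x) | exists x].
by apply: lb_le_inf => //; exists (g x); exists x.
Qed.

(** * Consequences of strong convexity and of the Lipschitz bounds *)

Lemma strongly_convexE (R : realType) M (n : 'I_M -> nat) (L : 'I_M -> R)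
    (f : 'cV[R]_(\sum_(j < M) n j) -> R) (sigma1 : R) :
  (forall i, 0 < L i) -> strongly_convex1 f L sigma1 -> forall w v,
  f v + dot (grad f v) (w - v) + sigma1 / 2 * dot1 L (w - v) (w - v) <= f w.
Proof. by move=> L0 fs w v; rewrite -norm1_sqr. Qed.

Lemma subgradient_ineq (R : realType) M (n : 'I_M -> nat) (L : 'I_M -> R)
    (f : 'cV[R]_(\sum_(j < M) n j) -> R) (sigma1 : R) :
  (forall i, 0 < L i) -> 0 < sigma1 -> strongly_convex1 f L sigma1 ->
  forall w v, f v + dot (grad f v) (w - v) <= f w.
Proof.
move=> L0 s0 fs w v; apply: le_trans (strongly_convexE L0 fs w v).
by rewrite lerDl mulr_ge0 ?dot1_ge0 // divr_ge0 // ltW.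
Qed.

(** The quadratic upper bound usually obtained by integrating the gradient.  Here
    the subgradient inequality at [u + E h] gives it with [L i] in place of
    [L i / 2].  If it holds with constant [c], applying it to the two halves of
    [h] improves the constant to [c / 2 + L i / 4].  Iterating this map, whose
    fixed point is [L i / 2], leads to the sharp constant in the limit. *)
Lemma block_descent (R : realType) M (n : 'I_M -> nat) (L : 'I_M -> R)
    (f : 'cV[R]_(\sum_(j < M) n j) -> R) i :
  0 < L i -> coord_lipschitz f L ->
  (forall w v, f v + dot (grad f v) (w - v) <= f w) ->
  forall u h, f (u + Eblock R n i *m h)
    <= f u + dot (pgrad f i u) h + L i / 2 * dot h h.
Proof.
move=> Li0 fL fg u h.
have lip v g : dot (pgrad f i (v + Eblock R n i *m g) - pgrad f i v) g
    <= L i * dot g g by exact/dot_le_of_enorm_le/fL.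
suff bound k : forall v g, f (v + Eblock R n i *m g)
    <= f v + dot (pgrad f i v) g + (L i / 2 + L i / 2 * 2^-1 ^+ k) * dot g g.
  apply: (@ler_geometric_error _ _ _ (L i / 2 * dot h h)) => k.
  have := bound k u h; lra.
elim: k => [|k IHk] v g.
  (* The subgradient inequality is taken at the far endpoint. *)
  have := fg v (v + Eblock R n i *m g); have := lip v g.
  rewrite opprD addrA subrr add0r dotNr dot_mulmx -/(pgrad _ _ _) !dotE expr0.
  lra.
set g2 := 2^-1 *: g.
have -> : v + Eblock R n i *m g = v + Eblock R n i *m g2 + Eblock R n i *m g2.
  by rewrite -addrA -mulmxDr -scalerDl (_ : 2^-1 + 2^-1 = 1) ?scale1r //; lra.
have := IHk (v + Eblock R n i *m g2) g2; have := IHk v g2; have := lip v g2.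
rewrite /g2 !dotE exprS; lra.
Qed.

(** Along a single block, strong convexity bounds [f] from below by a quadratic of
    curvature [sigma1 * L i] and [block_descent] bounds it from above by one of
    curvature [L i], with the same linear part.  The blocks must be nonempty for
    a nonzero direction [h] to exist. *)
Lemma modulus_le1 (R : realType) M (n : 'I_M -> nat) (L : 'I_M -> R)
    (f : 'cV[R]_(\sum_(j < M) n j) -> R) (sigma1 : R) :
  (0 < M)%N -> (forall i, 0 < n i)%N -> (forall i, 0 < L i) ->
  coord_lipschitz f L -> 0 < sigma1 -> strongly_convex1 f L sigma1 ->
  sigma1 <= 1.
Proof.
move=> M0 n0 L0 fL s0 fs; pose i := Ordinal M0.
pose h : 'cV[R]_(n i) := const_mx 1.
have h0 : 0 < dot h h.
  rewrite /dot (eq_bigr (fun=> 1)) => [|j _]; last by rewrite mxE mulr1.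
  by rewrite sumr_const card_ord ltr0n.
have norm_h : dot1 L (Eblock R n i *m h) (Eblock R n i *m h) = L i * dot h h.
  rewrite /dot1 (bigD1 i) //= dot_submxcol_Eblock eqxx big1 ?addr0 // => j ne_ji.
  by rewrite dot_submxcol_Eblock (negbTE ne_ji) mulr0.
have := block_descent (L0 i) fL (subgradient_ineq L0 s0 fs) 0 h.
have := strongly_convexE L0 fs (0 + Eblock R n i *m h) 0.
rewrite add0r subr0 norm_h dot_mulmx -/(pgrad _ _ _) => lo up.
have Lh0 : 0 < L i * dot h h by rewrite mulr_gt0.
rewrite -(ler_pM2r Lh0); lra.
Qed.

(** With [w = ustar + t *: (x - ustar)], averaging the strong convexity inequalities
    at [w] towards [x] (weight [t]) and towards [ustar] (weight [1 - t]) cancels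
    the gradient of [f] at [w].  Since [f ustar <= f w], what remains is the claim
    with an extra factor [1 - t] on the left. *)
Lemma quadratic_growth (R : realType) M (n : 'I_M -> nat)
    (U : forall i : 'I_M, set 'cV[R]_(n i)) (L : 'I_M -> R)
    (f : 'cV[R]_(\sum_(j < M) n j) -> R) (sigma1 : R) ustar x :
  (forall i, convex_set (U i)) -> (forall i, 0 < L i) ->
  strongly_convex1 f L sigma1 -> minimizer (prodset U) f ustar ->
  prodset U x ->
  sigma1 / 2 * dot1 L (x - ustar) (x - ustar) <= f x - f ustar.
Proof.
move=> cU L0 fs [Us min_s] Ux.
apply: (@ler_geometric_error _ _ _
  (sigma1 / 2 * dot1 L (x - ustar) (x - ustar))) => k.
have /andP[t0 t1] := half_pow_itv R k.
set t := 2^-1 ^+ k in t0 t1 *; pose w := ustar + t *: (x - ustar).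
have Uw : prodset U w.
  move=> i; rewrite submxcolD submxcolZ submxcolB.
  exact: segment_in_convex (cU i) (Us i) (Ux i) (ltW t0) t1.
have := strongly_convexE L0 fs x w; have := strongly_convexE L0 fs ustar w.
have -> : x - w = (1 - t) *: (x - ustar).
  by rewrite scalerBl scale1r opprD addrA.
have -> : ustar - w = - t *: (x - ustar).
  by rewrite opprD addrA subrr add0r scaleNr.
have := min_s w Uw; move: (x - ustar) => d.
rewrite !dotZr !dot1E => le_w lo_s lo_x.
rewrite -(ler_pM2l t0); nra.
Qed.

(** * One step of the parallel method *)

(** Jensen's inequality at [xp] is obtained by adding the subgradient inequalities
    at [xp] towards the [M] single-block moves ([lower]), whose displacements from
    [xp] add up to zero. *)
Lemma parallel_descent (R : realType) M (n : 'I_M -> nat) (L : 'I_M -> R)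
    (f : 'cV[R]_(\sum_(j < M) n j) -> R) x d :
  (0 < M)%N -> (forall i, 0 < L i) -> coord_lipschitz f L ->
  (forall w v, f v + dot (grad f v) (w - v) <= f w) ->
  f (x + M%:R^-1 *: d)
    <= f x + M%:R^-1 * (dot (grad f x) d + 2^-1 * dot1 L d d).
Proof.
move=> M0 L0 fL fg; set xp := x + _.
have MR0 : 0 < M%:R :> R by rewrite ltr0n.
have lower i : f xp + dot (grad f xp) (- (M%:R^-1 *: d))
      + dot (submxcol (grad f xp) i) (submxcol d i)
    <= f (x + Eblock R n i *m submxcol d i).
  apply: le_trans (fg _ xp); rewrite -addrA lerD2l -pgradE /pgrad -dot_mulmx.
  by rewrite -dotDr /xp opprD addrACA subrr add0r addrC.
have upper i : f (x + Eblock R n i *m submxcol d i)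
    <= f x + dot (submxcol (grad f x) i) (submxcol d i)
       + L i / 2 * dot (submxcol d i) (submxcol d i).
  by rewrite -pgradE; exact: block_descent.
have : \sum_(i < M) (f xp + dot (grad f xp) (- (M%:R^-1 *: d))
      + dot (submxcol (grad f xp) i) (submxcol d i))
    <= \sum_(i < M) (f x + dot (submxcol (grad f x) i) (submxcol d i)
       + L i / 2 * dot (submxcol d i) (submxcol d i)).
  by apply: ler_sum => i _; exact: le_trans (lower i) (upper i).
have sum_cst (c : R) : \sum_(i < M) c = M%:R * c.
  by rewrite sumr_const card_ord mulr_natl.
rewrite !big_split /= !sum_cst -!dot_submxcol.
rewrite (eq_bigr (fun i => 2^-1 * (L i * dot (submxcol d i) (submxcol d i)))).
  rewrite -mulr_sumr -/(dot1 L d d) dotNr dotZr => le_sum.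
  rewrite -(ler_pM2l MR0) mulrDr mulrA mulfV ?gt_eqF // mul1r.
  have MVM : M%:R * M%:R^-1 = 1 :> R by rewrite mulfV ?gt_eqF.
  move: le_sum; rewrite mulrN mulrA MVM; lra.
by move=> i _; rewrite mulrCA mulrA.
Qed.

(** Only because the block problems are proximal steps in the metric [L i] do their
    optimality conditions add up to one inequality for [dot1 L]. *)
Lemma block_prox_vi (R : realType) M (n : 'I_M -> nat)
    (U : forall i : 'I_M, set 'cV[R]_(n i)) (L : 'I_M -> R)
    (f : 'cV[R]_(\sum_(j < M) n j) -> R)
    (x v y : 'cV[R]_(\sum_(j < M) n j)) :
  (forall i, convex_set (U i)) ->
  (forall i, minimizer (U i) (@coord_model R M n f L x i) (submxcol v i)) ->
  prodset U y ->
  0 <= dot (grad f x) (y - v) + dot1 L (v - x) (y - v).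
Proof.
move=> cU min_v Uy; rewrite dot_submxcol -big_split; apply: sumr_ge0 => i _ /=.
rewrite -dotZl -dotDl -pgradE !submxcolB.
exact: minimizer_quadratic_vi (cU i) (min_v i) (Uy i).
Qed.

(** With [m = M%:R^-1], the term [|d|_1^2] enters with coefficient [m ^+ 2 / 2]
    from the square, [m / 2] from [parallel_descent] and [- m] from
    [block_prox_vi].  The total [m * (m - 1) / 2] is nonpositive as [m <= 1]. *)
Lemma potential_step (R : realType) M (n : 'I_M -> nat)
    (U : forall i : 'I_M, set 'cV[R]_(n i)) (L : 'I_M -> R)
    (f : 'cV[R]_(\sum_(j < M) n j) -> R)
    (x v xp y : 'cV[R]_(\sum_(j < M) n j)) :
  (0 < M)%N -> (forall i, convex_set (U i)) -> (forall i, 0 < L i) ->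
  coord_lipschitz f L ->
  (forall w v, f v + dot (grad f v) (w - v) <= f w) ->
  (forall i, minimizer (U i) (@coord_model R M n f L x i) (submxcol v i)) ->
  prodset U y ->
  xp = x + M%:R^-1 *: (v - x) ->
  2^-1 * dot1 L (xp - y) (xp - y) + f xp
    <= 2^-1 * dot1 L (x - y) (x - y) + f x
       + M%:R^-1 * dot (grad f x) (y - x).
Proof.
move=> M0 cU L0 fL fg min_v Uy xpE.
have := parallel_descent x (v - x) M0 L0 fL fg.
have := block_prox_vi cU min_v Uy; rewrite -xpE.
have -> : xp - y = (x - y) + M%:R^-1 *: (v - x) by rewrite xpE addrAC.
have -> : y - v = - (x - y) - (v - x) by rewrite opprB opprB addrA subrK.
have -> : y - x = - (x - y) by rewrite opprB.
move: (v - x) (x - y) (dot1_ge0 (v - x) L0) => d e dd0.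
have : 0 < (M%:R^-1 : R) <= 1.
  by rewrite invr_gt0 ltr0n M0 invf_le1 ?ltr0n // ler1n.
move: M%:R^-1 => m /andP[m0 m1].
rewrite !dotE !dot1E (dot1C L d e) => vi descent.
have : m * (1 - m) * dot1 L d d >= 0 by rewrite !mulr_ge0 ?subr_ge0 // ltW.
have := mulr_ge0 (ltW m0) vi. lra.
Qed.

Lemma prodset_average (R : realType) M (n : 'I_M -> nat)
    (U : forall i : 'I_M, set 'cV[R]_(n i)) x v :
  (0 < M)%N -> (forall i, convex_set (U i)) -> prodset U x -> prodset U v ->
  prodset U (x + M%:R^-1 *: (v - x)).
Proof.
move=> M0 cU Ux Uv i; rewrite submxcolD submxcolZ submxcolB.
by apply: segment_in_convex; rewrite ?invf_le1 ?invr_ge0 ?ltr0n ?ler1n.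
Qed.

Lemma pcdm_stepE (R : realType) M (n : 'I_M -> nat)
    (f : 'cV[R]_(\sum_(j < M) n j) -> R) (L : 'I_M -> R)
    (U : forall i : 'I_M, set 'cV[R]_(n i)) u k :
  (0 < M)%N -> pcdm_seq f L U u ->
  exists v, (forall i, minimizer (U i) (@coord_model R M n f L (u k) i)
                         (submxcol v i))
    /\ u k.+1 = u k + M%:R^-1 *: (v - u k).
Proof.
move=> M0 [_ /(_ k) /fin_all_exists[v vP]].
have MR0 : M%:R != 0 :> R by rewrite pnatr_eq0 -lt0n.
exists (\mxcol_i v i); split=> [i|]; first by rewrite mxcolK; case: (vP i).
apply/mxcolP => i; have [_ ->] := vP i.
rewrite submxcolD submxcolZ submxcolB mxcolK scalerBr addrCA.
by rewrite mulrBl mulfV // scalerBl scale1r mul1r.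
Qed.

Theorem theorem2 (R : realType) (M : nat) (n : 'I_M -> nat)
    (hM : (1 <= M)%N) (hn : forall i : 'I_M, (0 < n i)%N)
    (U : forall i : 'I_M, set 'cV[R]_(n i))
    (hU0 : forall i : 'I_M, U i !=set0)
    (hUcl : forall i : 'I_M, closed (U i))
    (hUcv : forall i : 'I_M, convex_set (U i))
    (L : 'I_M -> R) (hL : forall i : 'I_M, 0 < L i)
    (f : 'cV[R]_(\sum_(j < M) n j) -> R)
    (hfcv : convex_function setT f)
    (hfd : forall u : 'cV[R]_(\sum_(j < M) n j), differentiable f u)
    (hfL : coord_lipschitz f L)
    (sigma1 : R) (hsigma : 0 < sigma1)
    (hfs : strongly_convex1 f L sigma1)
    (ustar : 'cV[R]_(\sum_(j < M) n j))
    (hustar : minimizer (prodset U) f ustar)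
    (u : nat -> 'cV[R]_(\sum_(j < M) n j))
    (hu : pcdm_seq f L U u) :
  let fstar := opt_value (prodset U) f in
  let r0 := norm1 L (u 0%N - ustar) in
  forall k : nat,
    f (u k) - fstar <=
      (1 - 2 * sigma1 / (M%:R * (1 + sigma1))) ^+ k
      * (1 / 2 * r0 ^+ 2 + f (u 0%N) - fstar).
Proof.
move=> fstar r0.
rewrite /fstar (opt_value_minimizer hustar) {fstar} /r0 norm1_sqr // mul1r.
have MR1 : 1 <= M%:R :> R by rewrite ler1n.
have s1 := modulus_le1 hM hn hL hfL hsigma hfs.
have fg := subgradient_ineq hL hsigma hfs.
have inU k : prodset U (u k).
  elim: k => [|k IHk]; first by case: hu.
  have [v [min_v ->]] := pcdm_stepE k hM hu.
  by apply: prodset_average => // i; case: (min_v i).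
set rho := 1 - _.
have rhoE : rho = 1 - M%:R^-1 * (2 * sigma1 / (1 + sigma1)).
  by rewrite /rho; congr (1 - _); field; rewrite ?gt_eqF //; lra.
have gamma_le1 : 2 * sigma1 / (1 + sigma1) <= 1.
  by rewrite ler_pdivrMr; lra.
have rho_ge0 : 0 <= rho.
  rewrite rhoE subr_ge0 mulr_ile1 ?invr_ge0 ?divr_ge0 ?invf_le1 //; lra.
pose Phi k := 2^-1 * dot1 L (u k - ustar) (u k - ustar) + f (u k) - f ustar.
have contract k : Phi k.+1 <= rho * Phi k.
  have [v [min_v uE]] := pcdm_stepE k hM hu.
  have := potential_step hM hUcv hL hfL fg min_v hustar.1 uE; rewrite /Phi.
  have := quadratic_growth hUcv hL hfs hustar (inU k).
  have := strongly_convexE hL hfs ustar (u k).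
  have -> : dot1 L (ustar - u k) (ustar - u k)
      = dot1 L (u k - ustar) (u k - ustar).
    by rewrite -opprB dot1Nl dot1Nr opprK.
  rewrite rhoE; set N := dot1 L (u k - ustar) _; set D := dot _ _.
  move=> strong growth step.
  (* After multiplication by [1 + sigma1], right minus left is [gap]. *)
  have key : 2 * sigma1 / (1 + sigma1) * (2^-1 * N + f (u k) - f ustar)
      <= f (u k) - f ustar + sigma1 / 2 * N.
    have := mulr_ge0 (_ : 0 <= 1 - sigma1)
                     (_ : 0 <= f (u k) - f ustar - sigma1 / 2 * N).
    rewrite !subr_ge0 => /(_ s1 growth) gap.
    rewrite mulrAC ler_pdivrMr; lra.
  have m0 : 0 < M%:R^-1 :> R by rewrite invr_gt0 (lt_le_trans ltr01).
  have := ler_wpM2l (ltW m0) key.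
  have : M%:R^-1 * D <= M%:R^-1 * (f ustar - f (u k) - sigma1 / 2 * N).
    by rewrite ler_pM2l //; lra.
  lra.
move=> k; apply: (@le_trans _ _ (Phi k)).
  by rewrite /Phi -addrA lerDr mulr_ge0 ?dot1_ge0 // invr_ge0.
elim: k => [|k IHk]; first by rewrite expr0 mul1r.
apply: le_trans (contract k) _; rewrite exprS -mulrA.
exact: ler_wpM2l.
Qed.
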